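(* Let $X$ be a compact hyper-Kähler manifold, $b_2=b_2(X)$, $r=\lfloor b_2/2\rfloor$, and $\mathfrak g\cong\mathfrak{so}(b_2+2,\mathbb C)$. Let $V_\mu$ be the irreducible $\mathfrak g$-module of highest weight $\mu=(\mu_0,\dots,\mu_r)$. If $\mu_r\ge 0$, then $$s(V_\mu)=8\cdot\frac{\left(\sum_{i=0}^r\mu_i\right)b_2+\sum_{i=0}^r\left((\mu_i-i)^2-i^2\right)}{(b_2+1)(b_2+2)} .$$ If $b_2$ is even and $\mu_r<0$, then $s(V_\mu)=s(V_{\mu'})$, where $\mu'=(\mu_0,\dots,\mu_{r-1},-\mu_r)$.
   Context: A compact hyper-Kähler manifold is a simply connected compact Kähler manifold whose space of holomorphic $2$-forms is spanned by an everywhere nondegenerate form. Its Looijenga--Lunts--Verbitsky algebra $\mathfrak g$ is isomorphic to $\mathfrak{so}(V,q)\cong\mathfrak{so}(b_2+2,\mathbb C)$, where $(V,q)$ is a nondegenerate quadratic space of dimension $b_2+2$; the statement only involves $\mathfrak g$ as this Lie algebra. Weights. $\mathfrak g$ has rank $r+1$. Fix a Cartan and a Borel subalgebra and a basis $\varepsilon_0,\dots,\varepsilon_r$ of the dual Cartan subalgebra such that the weights of the standard module $V$ are $\pm\varepsilon_0,\dots,\pm\varepsilon_r$ if $b_2=2r$ is even, and $0,\pm\varepsilon_0,\dots,\pm\varepsilon_r$ if $b_2=2r+1$ is odd. A dominant integral weight is written $\mu=(\mu_0,\dots,\mu_r)=\sum_i\mu_i\varepsilon_i$; the $\mu_i$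 are all in $\mathbb Z$ or all in $\frac12\mathbb Z\setminus\mathbb Z$, with $\mu_0\ge\cdots\ge\mu_{r-1}\ge|\mu_r|\ge0$ if $b_2=2r$, and $\mu_0\ge\cdots\ge\mu_r\ge0$ if $b_2=2r+1$. The constant $s$. Let $h=\varepsilon_0^\vee$ be the element of the Cartan subalgebra acting on the weight space of weight $\theta=\sum_i\theta_i\varepsilon_i$ as multiplication by $2\theta_0$. A (finite-dimensional) $\mathfrak g$-module $W$ decomposes as $W=\bigoplus_{k\in\mathbb Z}W_k$ with $W_k$ the $h$-eigenspace of eigenvalue $k$. If $\sum_k(-1)^k\dim W_k\ne0$ (automatic for $W$ irreducible), define $$s(W)=\frac{\sum_{k\in\mathbb Z}(-1)^kk^2\dim W_k}{\sum_{k\in\mathbb Z}(-1)^k\dim W_k}\in\mathbb Q .$$ *)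

(* Defs.v *)
From HB Require Import structures.
From mathcomp Require Import all_boot all_order all_algebra.
From mathcomp Require Import boolp classical_sets fsbigop reals.
From mathcomp Require Import complex.

Set Implicit Arguments.
Unset Strict Implicit.
Unset Printing Implicit Defensive.

Import Order.TTheory GRing.Theory Num.Theory.

Local Open Scope ring_scope.

Section LinearLieAlgebras.
Variables (F : fieldType) (V : vectType F).

Definition lie_bracket (x y : 'End(V)) : 'End(V) := ((x \o y) - (y \o x))%VF.

(* The span of all brackets of an element of A with an element of B. *)
Definition lie_prod (A B : {vspace 'End(V)}) : {vspace 'End(V)} :=
  <<[seq lie_bracket x y | x <- vbasis A, y <- vbasis B]>>%VS.

Definition lie_solvable (A : {vspace 'End(V)}) : Prop :=
  exists n, iter n (fun U => lie_prod U U) A = 0%VS.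

Definition lie_nilpotent (A : {vspace 'End(V)}) : Prop :=
  exists n, iter n (lie_prod A) A = 0%VS.

(* The orthogonal Lie algebra so(V, q); q is the symmetric bilinear form of
   the quadratic space. *)
Definition so (q : {symmetric V}) : set 'End(V) :=
  [set x | forall u v, q (x u) v + q u (x v) = 0]%classic.

Definition so_subalgebra (q : {symmetric V}) (A : {vspace 'End(V)}) : Prop :=
  (forall x, x \in A -> so q x) /\ (lie_prod A A <= A)%VS.

Definition cartan_subalgebra (q : {symmetric V}) (H : {vspace 'End(V)}) : Prop :=
  [/\ so_subalgebra q H,
      lie_nilpotent H
    & forall x, so q x -> (forall y, y \in H -> lie_bracket x y \in H) ->
        x \in H].

Definition borel_subalgebra (q : {symmetric V}) (B : {vspace 'End(V)}) : Prop :=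
  [/\ so_subalgebra q B,
      lie_solvable B
    & forall B' : {vspace 'End(V)},
        so_subalgebra q B' -> lie_solvable B' -> (B <= B')%VS -> B' = B].

End LinearLieAlgebras.

Section Modules.
Variables (F : fieldType) (V : vectType F) (q : {symmetric V}).

(* A representation of so(V, q) on W is given by a map on all of 'End(V); only
   its values on so(V, q) are constrained, and only those are ever used. *)
Definition so_module (W : vectType F) (rho : 'End(V) -> 'End(W)) : Prop :=
  (forall a x y, so q x -> so q y -> rho (a *: x + y) = a *: rho x + rho y) /\
  (forall x y, so q x -> so q y ->
     rho (lie_bracket x y) = lie_bracket (rho x) (rho y)).

Definition irreducible_so_module (W : vectType F) (rho : 'End(V) -> 'End(W)) :
    Prop :=
  [/\ so_module rho,
      \dim {:W} != 0%N
    & forall U : {vspace W},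
        (forall x, so q x -> (rho x @: U <= U)%VS) -> U = 0%VS \/ U = {:W}%VS].

Variable H : {vspace 'End(V)}.

Definition weight_vector (W : lmodType F) (act : 'End(V) -> W -> W)
    (theta : 'Hom(subvs_of H, F^o)) (w : W) : Prop :=
  w != 0 /\ forall x : subvs_of H, act (vsval x) w = theta x *: w.

Definition root_vector (alpha : 'Hom(subvs_of H, F^o)) (x : 'End(V)) : Prop :=
  alpha != 0 /\ weight_vector (@lie_bracket F V) alpha x.

Variable r : nat.

(* The weights of the standard module are the +-eps_i, together with 0 when
   dim V = b2 + 2 is odd; the positive roots of B are the usual ones, i.e. those
   for which the dominant weights are the mu with
   mu_0 >= ... >= mu_(r-1) >= |mu_r| (b2 even), resp.
   mu_0 >= ... >= mu_r >= 0 (b2 odd). *)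
Record cartan_borel_datum (b2 : nat) (B : {vspace 'End(V)})
    (eps : 'I_r.+1 -> 'Hom(subvs_of H, F^o)) : Prop := CartanBorelDatum {
  cbd_cartan : cartan_subalgebra q H;
  cbd_borel : borel_subalgebra q B;
  cbd_sub : (H <= B)%VS;
  cbd_basis : basis_of fullv [seq eps i | i : 'I_r.+1];
  cbd_weights : forall theta : 'Hom(subvs_of H, F^o),
    (exists v : V, weight_vector (fun x v => x v) theta v) <->
    (exists i, theta = eps i \/ theta = - eps i) \/ (odd b2 /\ theta = 0);
  cbd_roots : forall alpha : 'Hom(subvs_of H, F^o),
    (exists2 x, x \in B & root_vector alpha x) <->
    (exists i j : 'I_r.+1,
       (i < j)%N /\ (alpha = eps i - eps j \/ alpha = eps i + eps j)) \/
    (odd b2 /\ exists i, alpha = eps i) }.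

(* The element h = eps_0^vee of the Cartan subalgebra. *)
Definition is_eps0_check (eps : 'I_r.+1 -> 'Hom(subvs_of H, F^o))
    (h : subvs_of H) : Prop :=
  forall theta : 'I_r.+1 -> F,
    (\sum_i theta i *: eps i) h = 2 * theta ord0.

Definition has_highest_weight (B : {vspace 'End(V)}) (W : vectType F)
    (rho : 'End(V) -> 'End(W)) (mu : 'Hom(subvs_of H, F^o)) : Prop :=
  exists w : W, weight_vector (fun x w => rho x w) mu w /\
    forall alpha x, x \in B -> root_vector alpha x -> rho x w = 0.

End Modules.

Definition is_int (x : rat) : Prop := exists m : int, x = m%:~R.

Definition is_half_int (x : rat) : Prop := exists m : int, x = m%:~R + 2^-1.

Definition dominant_integral (b2 r : nat) (mu : 'I_r.+1 -> rat) : Prop :=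
  [/\ (forall i, is_int (mu i)) \/ (forall i, is_half_int (mu i)),
      (forall i j : 'I_r.+1, (i <= j < r)%N -> mu j <= mu i),
      (forall i : 'I_r.+1, (i < r)%N -> `|mu ord_max| <= mu i)
    & odd b2 -> 0 <= mu ord_max].

Definition weight_of (F : fieldType) (V : vectType F) (H : {vspace 'End(V)})
    (r : nat) (eps : 'I_r.+1 -> 'Hom(subvs_of H, F^o)) (mu : 'I_r.+1 -> rat) :
    'Hom(subvs_of H, F^o) :=
  \sum_i ratr (mu i) *: eps i.

Definition flip_last (r : nat) (mu : 'I_r.+1 -> rat) : 'I_r.+1 -> rat :=
  fun i => if i == ord_max then - mu i else mu i.

(* The W_k, where hW is the action of h on W. *)
Definition h_part (F : fieldType) (W : vectType F) (hW : 'End(W)) (k : int) :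
    {vspace W} :=
  passmx.leigenspace hW k%:~R.

(* Both sums over all of int have finite support, as hW has finitely many
   eigenvalues. *)
Definition s_const (F : fieldType) (W : vectType F) (hW : 'End(W)) : rat :=
  (\sum_(k \in [set: int]%classic)
     ((-1) ^ k * k%:~R ^+ 2 * (\dim (h_part hW k))%:R : rat)) /
  (\sum_(k \in [set: int]%classic) ((-1) ^ k * (\dim (h_part hW k))%:R : rat)).

(* Main.v *)
Require Import Defs.
From HB Require Import structures.
From mathcomp Require Import all_boot all_order all_algebra.
From mathcomp Require Import boolp classical_sets fsbigop reals.
From mathcomp Require Import complex.
From mathcomp Require Import ring zify.

(** The signs in s(W) are constant when W is irreducible: h has eigenvalues 2, 0
    and -2 on V, hence integral even eigenvalues on so(V, q), so that the
    eigenvalues of h on W differ by even integers and s(W) is the ratio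
    tr_W(h^2) / dim W. This ratio is computed with a Casimir operator.

    For dual bases v, v' of V, and u ^ w the element x |-> q(w, x) u - q(u, x) w
    of so(V, q), put C = sum_{a, b} rho(v_a ^ v_b) rho(v'_b ^ v'_a). It depends
    only on the tensor inverse to q, not on the bases ([casimir_basis_free]),
    and commutes with so(V, q) because this tensor is invariant
    ([casimir_invariant]). As W is irreducible, C is the scalar by which it acts
    on a highest weight vector ([central_scalar]).

    The scalar is read off a basis of weight vectors of V, in which every
    v_a ^ v_b is a root vector or a multiple of a coroot: it equals
    2 sum_i mu_i (mu_i + b2 - 2 i) ([casimir_highest], [casimir_coef_sum]).

    The trace of C is read off an orthogonal basis e with norms n_a. Invariance
    of the trace form, applied to the brackets of e_a ^ e_b, e_b ^ e_c and
    e_a ^ e_c, shows that tr(rho(e_a ^ e_b)^2) / (n_a n_b) is the same for all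
    a <> b ([lfun_trace_wedge_sq]). Since h is itself proportional to some
    e_a ^ e_b, this gives tr C in terms of tr_W(h^2)
    ([casimir_trace_coroot]), and comparing with (dim W) times the scalar yields
    the formula, for all mu with 2 mu_0 integral. If b2 = 2 r, the last term of
    the sum is mu_r ^ 2, whence the invariance under the change of sign of
    mu_r. *)

Set Implicit Arguments.
Unset Strict Implicit.
Unset Printing Implicit Defensive.

Import Order.TTheory GRing.Theory Num.Theory.

Local Open Scope ring_scope.
Local Open Scope complex_scope.

(** * Traces and eigenspaces of endomorphisms *)

Section Trace.
Variable F : fieldType.

(** The choice of basis is immaterial by [lfun_traceC]. *)
Definition lfun_trace (W : vectType F) (f : 'End(W)) : F :=
  \tr (passmx.mxof (vbasis fullv) (vbasis fullv) f).

Lemma lfun_trace_is_linear (W : vectType F) : linear_for *%R (@lfun_trace W).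
Proof.
by move=> a f g; rewrite /lfun_trace passmx.mxof_linear mxtraceD mxtraceZ.
Qed.

HB.instance Definition _ (W : vectType F) :=
  GRing.isLinear.Build F 'End(W) F *%R (@lfun_trace W)
    (@lfun_trace_is_linear W).

Lemma lfun_traceC (U W : vectType F) (f : 'Hom(U, W)) (g : 'Hom(W, U)) :
  lfun_trace (f \o g)%VF = lfun_trace (g \o f)%VF.
Proof.
rewrite /lfun_trace (passmx.mxof_comp _ _ (vbasisP fullv)).
by rewrite [in RHS](passmx.mxof_comp _ _ (vbasisP fullv)) mxtrace_mulC.
Qed.

Lemma lfun_trace1 (W : vectType F) : lfun_trace (\1 : 'End(W)) = (\dim {:W})%:R.
Proof.
by rewrite /lfun_trace passmx.mxof1 ?mxtrace1 // (basis_free (vbasisP _)).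
Qed.

(** The eigenvectors are indexed by systems of eigenvalues, so that this covers
    both the eigenspaces of one operator and the weight spaces of a family.
    Applying T t - chi i t to a relation removes its i-th term. *)
Lemma common_eigenvectors_independent (W : vectType F) (S : Type)
    (T : S -> 'End(W)) (I : eqType) (s : seq I) (chi : I -> S -> F)
    (u : I -> W) :
  uniq s ->
  {in s &, forall i j, (forall t, chi i t = chi j t) -> i = j} ->
  {in s, forall i t, T t (u i) = chi i t *: u i} ->
  \sum_(i <- s) u i = 0 -> {in s, forall i, u i = 0}.
Proof.
elim: s u => [|i s IHs] u //= /andP[i_s s_uniq] chi_inj Tu sum_u.
have sub_s j : j \in s -> j \in i :: s by rewrite inE => ->; rewrite orbT.
have u_s : {in s, forall j, u j = 0}.
  move=> j js; have [//|uj_neq0] := eqVneq (u j) 0.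
  suff eij : i = j by rewrite eij js in i_s.
  apply: (chi_inj) => //; rewrite ?mem_head ?sub_s // => t.
  apply/esym/eqP; rewrite -subr_eq0.
  have: (chi j t - chi i t) *: u j = 0.
    apply: (IHs (fun k => (chi k t - chi i t) *: u k)) => //.
    - by move=> k l ks ls; apply: chi_inj; apply: sub_s.
    - by move=> k ks t'; rewrite linearZ /= Tu ?sub_s // scalerA mulrC -scalerA.
    have := congr1 (fun w => T t w - chi i t *: w) sum_u.
    rewrite linear0 scaler0 subr0 big_cons linearD scalerDr /=.
    rewrite Tu ?mem_head // opprD addrACA subrr add0r linear_sum.
    rewrite scaler_sumr -sumrB => sum0; rewrite -[RHS]sum0.
    by apply: eq_big_seq => k ks; rewrite /= Tu ?sub_s // scalerBl.
  by move/eqP; rewrite scaler_eq0 (negPf uj_neq0) orbF.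
move=> j; rewrite inE => /orP[/eqP->|/u_s //].
by move: sum_u; rewrite big_cons big_seq big1 ?addr0.
Qed.

Lemma memv_leigenspace (W : vectType F) (f : 'End(W)) a w :
  (w \in passmx.leigenspace f a) = (f w == a *: w).
Proof.
by rewrite memv_ker add_lfunE opp_lfunE scale_lfunE id_lfunE subr_eq0.
Qed.

Lemma leigenspaces_direct (W : vectType F) (f : 'End(W)) n (a : 'I_n -> F) :
  injective a -> directv (\sum_(i < n) passmx.leigenspace f (a i)).
Proof.
move=> a_inj; apply/directv_sum_independent => u fu u0 i _.
apply: (@common_eigenvectors_independent W unit (fun=> f) _
          (index_enum 'I_n) (fun i _ => a i)) (mem_index_enum i) => //.
- exact: index_enum_uniq.
- by move=> j k _ _ /(_ tt)/a_inj.
- by move=> j _ _; apply/eqP; rewrite -memv_leigenspace fu.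
Qed.

(** The projection on an eigenspace E factors as W -> E -> W, and the composite
    E -> W -> E is the identity, so that its trace is dim E. *)
Lemma lfun_trace_sqr_diagonalizable (W : vectType F) (f : 'End(W)) n
    (a : 'I_n -> F) :
  injective a -> (\sum_(i < n) passmx.leigenspace f (a i))%VS = fullv ->
  lfun_trace (f \o f)%VF =
    \sum_(i < n) a i ^+ 2 * (\dim (passmx.leigenspace f (a i)))%:R.
Proof.
move=> a_inj sumE; pose E i := passmx.leigenspace f (a i).
have dxE := leigenspaces_direct f a_inj.
pose p i := sumv_pi_for (esym sumE) i.
have pE i w : p i w \in E i by apply: memv_sum_pi.
have sum_p w : \sum_i p i w = w by rewrite sumv_pi_sum ?memvf.
have pK i w : w \in E i -> p i w = w.
  move=> Ew.
  have /eqP := sum_p w.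
  (* compare with the decomposition of w whose only nonzero term is w *)
  rewrite -[X in _ == X](_ : \sum_j (if j == i then w else 0) = w); last first.
    by rewrite -big_mkcond big_pred1_eq.
  rewrite (directv_sum_unique dxE) => [/forall_inP/(_ i isT)/eqP->|//|j _].
  - by rewrite eqxx.
  - by case: eqVneq => [->|_]; rewrite ?mem0v.
have tr_p i : lfun_trace (p i) = (\dim (E i))%:R.
  pose g := (linfun (vsproj (E i)) \o p i)%VF.
  pose j := linfun (@vsval _ _ (E i)).
  have -> : p i = (j \o g)%VF.
    by apply/lfunP => w; rewrite !(comp_lfunE, lfunE) /= vsprojK.
  rewrite lfun_traceC (_ : (g \o j)%VF = \1%VF).
    by rewrite lfun_trace1 dimvf.
  by apply/lfunP => w; rewrite !(comp_lfunE, lfunE) /= pK ?subvsP // vsvalK.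
have -> : (f \o f)%VF = \sum_i a i ^+ 2 *: p i.
  apply/lfunP => w; rewrite sum_lfunE comp_lfunE -{1}[w]sum_p 2!linear_sum /=.
  apply: eq_bigr => i _; have := pE i w; rewrite memv_leigenspace => /eqP fp.
  by rewrite fp linearZ /= fp scale_lfunE scalerA.
rewrite linear_sum; apply: eq_bigr => i _.
by rewrite linearZ /= tr_p.
Qed.

End Trace.

(** * The elements u ^ v of so(V, q) *)

Section Wedge.
Variables (F : fieldType) (V : vectType F) (q : {symmetric V}).
Implicit Types (u v w : V) (x : 'End(V)).

Lemma sym_formC u v : q u v = q v u.
Proof. by rewrite hermC expr0 mul1r. Qed.

Definition wedge_fun u v w : V := q v w *: u - q u w *: v.

Lemma wedge_fun_is_linear u v : linear (wedge_fun u v).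
Proof.
move=> a w w'; rewrite /wedge_fun !linearPr /= !scalerDl -!scalerA.
by rewrite scalerBr opprD addrACA.
Qed.

HB.instance Definition _ u v :=
  GRing.isLinear.Build F V V *:%R (wedge_fun u v) (wedge_fun_is_linear u v).

(** This is the isomorphism of the exterior square of V with so(V, q); in an
    orthonormal basis the u ^ v are the elementary antisymmetric matrices. *)
Definition wedge u v : 'End(V) := linfun (wedge_fun u v).

Lemma wedgeE u v w : wedge u v w = q v w *: u - q u w *: v.
Proof. by rewrite lfunE. Qed.

Lemma wedgeC u v : wedge u v = - wedge v u.
Proof. by apply/lfunP => w; rewrite opp_lfunE !wedgeE opprB. Qed.

Lemma wedgevv v : wedge v v = 0.
Proof. by apply/lfunP => w; rewrite zero_lfunE wedgeE subrr. Qed.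

Lemma wedge_linearl v : linear (wedge^~ v).
Proof.
move=> a u u'; apply/lfunP => w.
rewrite add_lfunE scale_lfunE !wedgeE linearPl /= scalerDl scalerDr scalerBr.
by rewrite opprD addrACA !scalerA [_ * a]mulrC.
Qed.

Lemma wedge_linearr u : linear (wedge u).
Proof.
move=> a v v'; rewrite wedgeC (wedge_linearl u) opprD -scalerN.
by rewrite -!wedgeC.
Qed.

Lemma wedge0l v : wedge 0 v = 0.
Proof.
by apply/lfunP => w; rewrite wedgeE linear0l scaler0 scale0r subrr zero_lfunE.
Qed.

Lemma wedge0r u : wedge u 0 = 0.
Proof. by rewrite wedgeC wedge0l oppr0. Qed.

Lemma wedgeZl a u v : wedge (a *: u) v = a *: wedge u v.
Proof. by have := wedge_linearl v a u 0; rewrite wedge0l !addr0. Qed.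

Lemma wedgeZr a u v : wedge u (a *: v) = a *: wedge u v.
Proof. by rewrite wedgeC wedgeZl wedgeC scalerN opprK. Qed.

Lemma wedgeDl u u' v : wedge (u + u') v = wedge u v + wedge u' v.
Proof. by have := wedge_linearl v 1 u u'; rewrite !scale1r. Qed.

Lemma wedgeDr u v v' : wedge u (v + v') = wedge u v + wedge u v'.
Proof. by have := wedge_linearr u 1 v v'; rewrite !scale1r. Qed.

(** If u and v are isotropic, u + v and u - v are orthogonal: this expresses a
    coroot through two vectors of an orthogonal basis. *)
Lemma wedge_sum_diff u v : wedge (u + v) (u - v) = - 2 *: wedge u v.
Proof.
rewrite wedgeDl !wedgeDr -[- v]scaleN1r !wedgeZr !wedgevv scaler0 addr0 add0r.
by rewrite (wedgeC v) scaleN1r -opprD -mulr2n -scaler_nat scaleNr.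
Qed.

Lemma wedge_so u v : so q (wedge u v).
Proof.
move=> w w'; rewrite !wedgeE linearBl linearBr /= !linearZl_LR !linearZr_LR /=.
rewrite (sym_formC w u) (sym_formC w v); ring.
Qed.

Lemma lie_bracketE x y v : lie_bracket x y v = x (y v) - y (x v).
Proof. by rewrite add_lfunE opp_lfunE !comp_lfunE. Qed.

Lemma so_formN x u v : so q x -> q (x u) v = - q u (x v).
Proof. by move=> /(_ u v)/eqP; rewrite addr_eq0 => /eqP. Qed.

Lemma lie_bracket_wedge x u v : so q x ->
  lie_bracket x (wedge u v) = wedge (x u) v + wedge u (x v).
Proof.
move=> xso; apply/lfunP => w; rewrite lie_bracketE add_lfunE !wedgeE.
rewrite linearB !linearZ /= !(so_formN _ _ xso).
by rewrite !scaleNr opprD -!addrA; congr (_ + _); rewrite addrC -addrA addrCA.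
Qed.

Lemma so_scale a x : so q x -> so q (a *: x).
Proof.
move=> xso u v; rewrite !scale_lfunE linearZl_LR linearZr_LR /=.
by rewrite -mulrDr xso mulr0.
Qed.

Lemma so_add x y : so q x -> so q y -> so q (x + y).
Proof.
move=> xso yso u v; rewrite !add_lfunE linearDl linearDr /=.
by rewrite addrACA xso yso addr0.
Qed.

Lemma so0 : so q 0.
Proof. by move=> u v; rewrite !zero_lfunE linear0l linear0r addr0. Qed.

Lemma so_sum I (s : seq I) (X : I -> 'End(V)) :
  (forall i, so q (X i)) -> so q (\sum_(i <- s) X i).
Proof.
move=> Xso; apply: (big_ind (so q)) => //; [exact: so0 | exact: so_add].
Qed.

End Wedge.

(** * Invariant contractions and the Casimir operator *)

Section Contraction.
Variables (F : fieldType) (V : vectType F) (q : {symmetric V}).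
Hypothesis q_nondeg : nondegenerate q.

Lemma nondegenerate_eq (u v : V) : (forall w, q u w = q v w) -> u = v.
Proof.
move=> q_uv; apply/eqP; rewrite -subr_eq0 -memv0 -(eqP q_nondeg).
by apply/mem_orthovP => w _; rewrite linearBl /= q_uv subrr.
Qed.

(** For a nondegenerate q this says that the inverse tensor of q is the sum of
    the v a (x) v' a, as it is for dual bases v and v'. *)
Definition resolves_form (I : finType) (v v' : I -> V) :=
  forall x y, q x y = \sum_a q x (v' a) * q (v a) y.

Lemma resolves_form_sym (I : finType) (v v' : I -> V) :
  resolves_form v v' -> resolves_form v' v.
Proof.
move=> vv' x y; rewrite sym_formC vv'; apply: eq_bigr => a _.
by rewrite mulrC (sym_formC q y) (sym_formC q x).
Qed.

Lemma resolves_form_expand (I : finType) (v v' : I -> V) :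
  resolves_form v v' -> forall x, x = \sum_a q x (v' a) *: v a.
Proof.
move=> vv' x; apply: nondegenerate_eq => y; rewrite vv' linear_sumlz /=.
by apply: eq_bigr => a _; rewrite linearZl_LR.
Qed.

Lemma linear_lincomb (Z : lmodType F) (f : V -> Z) : linear f ->
  forall (I : finType) (c : I -> F) (v : I -> V),
  f (\sum_a c a *: v a) = \sum_a c a *: f (v a).
Proof.
move=> f_lin I c v.
pose g : {linear V -> Z} := HB.pack f (GRing.isLinear.Build F V Z *:%R f f_lin).
have := linear_sum g (index_enum I) predT (fun a => c a *: v a).
by rewrite /= => ->; apply: eq_bigr => a _; rewrite -[f]/(g : V -> Z) linearZ.
Qed.

Section Bilinear.
Variables (Z : lmodType F) (f : V -> V -> Z).
Hypotheses (f_linl : forall y, linear (f^~ y)).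
Hypotheses (f_linr : forall x, linear (f x)).

(** Both sides evaluate f on the inverse tensor of q. *)
Lemma contraction_basis_free (I J : finType) (v v' : I -> V) (e e' : J -> V) :
  resolves_form v v' -> resolves_form e e' ->
  \sum_a f (v a) (v' a) = \sum_b f (e b) (e' b).
Proof.
move=> vv' ee'.
transitivity (\sum_a \sum_b q (v a) (e' b) *: f (e b) (v' a)).
  apply: eq_bigr => a _; rewrite [v a in LHS](resolves_form_expand ee').
  exact: (linear_lincomb (f_linl _)).
rewrite exchange_big; apply: eq_bigr => b _.
rewrite [e' b in RHS](resolves_form_expand (resolves_form_sym vv')).
rewrite (linear_lincomb (f_linr _)); apply: eq_bigr => a _.
by rewrite sym_formC.
Qed.

(** Expanding x (v a) and x (v' a), this is the antisymmetry of x for q. *)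
Lemma contraction_invariant (I : finType) (v v' : I -> V) x :
  resolves_form v v' -> so q x ->
  \sum_a (f (x (v a)) (v' a) + f (v a) (x (v' a))) = 0.
Proof.
move=> vv' xso; rewrite big_split /=; apply/eqP; rewrite addr_eq0; apply/eqP.
transitivity (\sum_a \sum_b q (x (v a)) (v' b) *: f (v b) (v' a)).
  apply: eq_bigr => a _; rewrite [x _ in LHS](resolves_form_expand vv').
  exact: (linear_lincomb (f_linl _)).
rewrite exchange_big -sumrN; apply: eq_bigr => b _.
rewrite [x (v' b)](resolves_form_expand (resolves_form_sym vv')).
rewrite (linear_lincomb (f_linr _)) -sumrN; apply: eq_bigr => a _.
by rewrite so_formN // scaleNr sym_formC.
Qed.

End Bilinear.

(** This reduces stability under so(V, q) to stability under the v a ^ v b. *)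
Lemma so_wedge_span (I : finType) (v v' : I -> V) x :
  resolves_form v v' -> so q x ->
  2 *: x = \sum_a wedge q (x (v a)) (v' a).
Proof.
move=> vv' xso; apply/lfunP => y; rewrite sum_lfunE scale_lfunE.
under eq_bigr do rewrite wedgeE.
rewrite sumrB (mulr2n 1) scalerDl scale1r; congr (_ + _).
  rewrite [y in LHS](resolves_form_expand vv') linear_sum.
  by apply: eq_bigr => a _; rewrite linearZ /= sym_formC.
rewrite [x y in LHS](resolves_form_expand (resolves_form_sym vv')) -sumrN.
apply: eq_bigr => a _.
by rewrite [q (x (v a)) _]so_formN // scaleNr opprK sym_formC.
Qed.

End Contraction.

Section Casimir.
Variables (F : fieldType) (V : vectType F) (q : {symmetric V}).
Hypothesis q_nondeg : nondegenerate q.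
Variables (W : vectType F) (rho : 'End(V) -> 'End(W)).
Hypothesis rho_mod : so_module q rho.

Let rhoD x y : so q x -> so q y -> rho (x + y) = rho x + rho y.
Proof.
by move=> xso yso; have := rho_mod.1 1 x y xso yso; rewrite !scale1r.
Qed.

Lemma so_module0 : rho 0 = 0.
Proof.
have := rhoD (so0 q) (so0 q); rewrite addr0 => /eqP.
by rewrite -subr_eq subrr eq_sym => /eqP.
Qed.

Lemma so_moduleZ a x : so q x -> rho (a *: x) = a *: rho x.
Proof.
move=> xso; have := rho_mod.1 a x 0 xso (so0 q).
by rewrite so_module0 !addr0.
Qed.

Lemma so_module_sum I (s : seq I) (X : I -> 'End(V)) :
  (forall i, so q (X i)) -> rho (\sum_(i <- s) X i) = \sum_(i <- s) rho (X i).
Proof.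
move=> Xso; elim: s => [|i s IHs]; first by rewrite !big_nil so_module0.
by rewrite !big_cons rhoD ?IHs //; apply: so_sum.
Qed.

(** Each unordered pair of indices is counted twice, so that this is twice the
    usual Casimir operator of so(V, q). *)
Definition casimir (I : finType) (v v' : I -> V) : 'End(W) :=
  \sum_a \sum_b (rho (wedge q (v a) (v b)) \o rho (wedge q (v' b) (v' a)))%VF.

Let rho_linl v : linear (fun u => rho (wedge q u v)).
Proof.
move=> a u u'; rewrite (wedge_linearl q v).
by rewrite rho_mod.1 //; apply: wedge_so.
Qed.

Let rho_linr u : linear (fun v => rho (wedge q u v)).
Proof.
move=> a v v'; rewrite (wedge_linearr q u).
by rewrite rho_mod.1 //; apply: wedge_so.
Qed.

Let term u v z w := (rho (wedge q u v) \o rho (wedge q z w))%VF.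

Let term_lin1 v z w : linear (fun u => term u v z w).
Proof.
by move=> a u u'; rewrite /term (rho_linl v) comp_lfunDl comp_lfunZl.
Qed.

Let term_lin2 u z w : linear (fun v => term u v z w).
Proof.
by move=> a v v'; rewrite /term (rho_linr u) comp_lfunDl comp_lfunZl.
Qed.

Let term_lin3 u v w : linear (fun z => term u v z w).
Proof.
by move=> a z z'; rewrite /term (rho_linl w) comp_lfunDr comp_lfunZr.
Qed.

Let term_lin4 u v z : linear (fun w => term u v z w).
Proof.
by move=> a w w'; rewrite /term (rho_linr z) comp_lfunDr comp_lfunZr.
Qed.

Lemma casimir_basis_free (I J : finType) (v v' : I -> V) (e e' : J -> V) :
  resolves_form q v v' -> resolves_form q e e' -> casimir v v' = casimir e e'.
Proof.
move=> vv' ee'.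
transitivity (\sum_a \sum_b term (v a) (e b) (e' b) (v' a)).
  apply: eq_bigr => a _.
  by apply: (contraction_basis_free q_nondeg (f := fun x y => term _ x y _)).
rewrite exchange_big [RHS]exchange_big; apply: eq_bigr => b _.
by apply: (contraction_basis_free q_nondeg (f := fun x y => term x _ _ y)).
Qed.

Lemma lie_bracket_comp (X Y Z : 'End(W)) :
  lie_bracket X (Y \o Z)%VF =
  ((lie_bracket X Y \o Z) + (Y \o lie_bracket X Z))%VF.
Proof.
rewrite /lie_bracket comp_lfunDl comp_lfunDr comp_lfunNl comp_lfunNr.
rewrite !comp_lfunA.
by rewrite addrA subrK.
Qed.

(** A bracket with rho x is a sum of four terms, one for each slot; they cancel
    by invariance of the contraction, in a and in b. *)
Lemma casimir_invariant (I : finType) (v v' : I -> V) x :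
  resolves_form q v v' -> so q x -> lie_bracket (rho x) (casimir v v') = 0.
Proof.
move=> vv' xso.
have brD Y Z : lie_bracket (rho x) (Y + Z) =
    lie_bracket (rho x) Y + lie_bracket (rho x) Z.
  by rewrite /lie_bracket comp_lfunDl comp_lfunDr opprD addrACA.
have br0 : lie_bracket (rho x) 0 = 0.
  by rewrite /lie_bracket comp_lfun0l comp_lfun0r subrr.
have br_sum (X : I -> 'End(W)) :
    lie_bracket (rho x) (\sum_a X a) = \sum_a lie_bracket (rho x) (X a).
  exact: (big_morph _ brD br0).
have br_term u w z y : lie_bracket (rho x) (term u w z y) =
    (term (x u) w z y + term u w z (x y)) +
    (term u (x w) z y + term u w (x z) y).
  rewrite lie_bracket_comp -!rho_mod.2 ?lie_bracket_wedge //;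
    try exact: wedge_so.
  rewrite !rhoD; try exact: wedge_so.
  by rewrite comp_lfunDl comp_lfunDr [X in _ + X]addrC addrACA.
rewrite /casimir br_sum.
under eq_bigr => a _ do [rewrite br_sum;
  under eq_bigr => b _ do rewrite br_term; rewrite big_split /=].
rewrite big_split /= exchange_big /= big1 ?big1 ?addr0 // => a _.
- by apply: (contraction_invariant q_nondeg (f := fun x y => term _ x y _)).
- by apply: (contraction_invariant q_nondeg (f := fun x y => term x _ _ y)).
Qed.

Section OrthogonalTrace.
Variables (I : finType) (e : I -> V).
Hypothesis e_orth : forall a b, a != b -> q (e a) (e b) = 0.
Hypothesis e_norm : forall a, q (e a) (e a) != 0.

Let n a := q (e a) (e a).
Let sq a b := lfun_trace (term (e a) (e b) (e a) (e b)) / (n a * n b).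

Let sqC a b : sq a b = sq b a.
Proof.
rewrite /sq /term wedgeC -scaleN1r so_moduleZ; last exact: wedge_so.
by rewrite scaleN1r comp_lfunNl comp_lfunNr opprK [n a * _]mulrC.
Qed.

Lemma lfun_trace_bracket (X Y Z : 'End(W)) :
  lfun_trace (lie_bracket X Y \o Z)%VF = lfun_trace (X \o lie_bracket Y Z)%VF.
Proof.
rewrite /lie_bracket comp_lfunDl comp_lfunDr comp_lfunNl comp_lfunNr.
rewrite !linearB /=.
by rewrite !comp_lfunA; congr (_ - _); rewrite -comp_lfunA lfun_traceC.
Qed.

(** Up to norms, e a ^ e b, e b ^ e c and e a ^ e c bracket as in so(3); the
    claim is tr([X, Y] Z) = tr(X [Y, Z]) for this triple. *)
Let sq_move a b c : a != b -> a != c -> b != c -> sq a b = sq a c.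
Proof.
move=> ab ac bc.
have rbr u w z y : rho (lie_bracket (wedge q u w) (wedge q z y)) =
    lie_bracket (rho (wedge q u w)) (rho (wedge q z y)).
  by apply: rho_mod.2; apply: wedge_so.
have:= lfun_trace_bracket (rho (wedge q (e a) (e b)))
  (rho (wedge q (e b) (e c))) (rho (wedge q (e a) (e c))).
rewrite -!rbr !lie_bracket_wedge; try exact: wedge_so.
have e0 := (e_orth ab, e_orth ac, e_orth bc,
  etrans (sym_formC q _ _) (e_orth ab), etrans (sym_formC q _ _) (e_orth ac),
  etrans (sym_formC q _ _) (e_orth bc)).
rewrite !wedgeE !e0 !scale0r !subr0 wedge0l wedge0r addr0 add0r.
rewrite wedgeZl wedgeZr !so_moduleZ; try exact: wedge_so.
rewrite -comp_lfunZl -comp_lfunZr !linearZ /= -/(n b) -/(n c) => eq_tr.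
rewrite /sq /term; apply/eqP; rewrite eqr_div ?mulf_neq0 ?e_norm //; apply/eqP.
by rewrite mulrCA [RHS]mulrCA [X in _ * X]mulrC -eq_tr [n b * _]mulrC.
Qed.

(** A pair can be changed into any other by replacing one index at a time. *)
Lemma lfun_trace_wedge_sq a b c d : a != b -> c != d -> sq a b = sq c d.
Proof.
move=> ab cd.
have [eac|ac] := eqVneq a c.
  have [<-|bd] := eqVneq b d; first by rewrite eac.
  by rewrite -eac; apply: sq_move => //; rewrite eac.
have [ebc|bc] := eqVneq b c.
  have [ead|ad] := eqVneq a d; first by rewrite sqC ebc ead.
  by rewrite sqC -ebc; apply: sq_move => //; [rewrite eq_sym | rewrite ebc].
rewrite (sq_move ab ac bc) sqC.
have [<-|ad] := eqVneq a d; first by [].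
by apply: sq_move => //; rewrite eq_sym.
Qed.

Lemma casimir_trace a b : a != b ->
  lfun_trace (casimir e (fun c => (q (e c) (e c))^-1 *: e c)) =
  - (#|I| * #|I|.-1)%:R *
    (lfun_trace (rho (wedge q (e a) (e b)) \o rho (wedge q (e a) (e b)))%VF /
      (q (e a) (e a) * q (e b) (e b))).
Proof.
move=> ab; rewrite -[X in _ * X]/(sq a b) linear_sum /=.
rewrite (eq_bigr (fun=> - #|I|.-1%:R * sq a b)) => [|c _].
  by rewrite sumr_const -[in LHS]mulr_natl natrM; ring.
rewrite linear_sum (bigD1 c) //= wedgevv so_module0 comp_lfun0l linear0 add0r.
rewrite (eq_bigr (fun=> - sq a b)) => [|d dc].
  by rewrite sumr_const -[in LHS]mulr_natl cardC1 mulrN mulNr.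
rewrite wedgeZl wedgeZr [wedge q (e d) _]wedgeC !scalerN scalerA -scaleNr.
rewrite so_moduleZ; last exact: wedge_so.
rewrite -comp_lfunZr linearZ /= (@lfun_trace_wedge_sq a b c d) // 1?eq_sym //.
by rewrite /sq /n /term invfM; ring.
Qed.

End OrthogonalTrace.
End Casimir.

(** * Weight bases of the standard module *)

Section WittIndex.
Variables (r : nat) (o : bool).

(** The weights of the standard module: [inl (true, i)], [inl (false, i)] and
    [inr _] stand for eps_i, - eps_i and 0, the last one if o holds. *)
Definition witt_index : finType := ((bool * 'I_r.+1) + 'I_o)%type.
Implicit Types a b : witt_index.

Definition opp_index a : witt_index :=
  match a with inl (s, i) => inl (~~ s, i) | inr z => inr z end.

Definition charge a (i : 'I_r.+1) : int :=
  match a with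
  | inl (s, j) => if j == i then (if s then 1 else - 1) else 0
  | inr _ => 0
  end.

(** A numerical test for positivity: the sum of two distinct weights is a
    positive root, zero, or a negative root according to whether their heights
    add up to less than, exactly, or more than 2 (r + 1). *)
Definition height a : nat :=
  match a with
  | inl (true, i) => i
  | inl (false, i) => r.+1.*2 - i
  | inr _ => r.+1
  end.

Lemma opp_indexK : involutive opp_index.
Proof. by case=> [[s i]|z] //=; rewrite negbK. Qed.

Lemma inl_eqE (s : bool) (i j : 'I_r.+1) :
  (inl (s, i) == inl (s, j) :> witt_index) = (i == j).
Proof. by apply/eqP/eqP => [[]|->]. Qed.

Lemma charge_opp a i : charge (opp_index a) i = - charge a i.
Proof.
by case: a => [[[] j]|z] //=; case: eqP => //=; rewrite ?oppr0 ?opprK.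
Qed.

Lemma odd_ord_eq (z z' : 'I_o) : z = z'.
Proof.
apply/val_inj; case: z z' => [m ltm] [n ltn] /=.
by move: ltm ltn; case: (o) => //=; case: m n => [|m] [|n].
Qed.

Lemma charge_inj a b : charge a =1 charge b -> a = b.
Proof.
case: a b => [[s i]|z] [[t j]|z'] eq_ab; last by rewrite (odd_ord_eq z z').
- move: (eq_ab i); rewrite /= eqxx; case: (j =P i) => [->|_];
    last by case: s {eq_ab}.
  by case: s t {eq_ab} => [] [].
- by move: (eq_ab i); rewrite /= eqxx; case: s {eq_ab}.
- by move: (eq_ab j); rewrite /= eqxx; case: t {eq_ab}.
Qed.

Lemma height_opp a : (height (opp_index a) + height a = r.+1.*2)%N.
Proof. by case: a => [[[] i]|z] //=; try (have := ltn_ord i); lia. Qed.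

Lemma height_inj : injective height.
Proof.
case=> [[[] i]|z] [[[] j]|z'] /= eq_ab;
  try (have := ltn_ord i); try (have := ltn_ord j); try lia.
- by move=> _ _; congr (inl (_, _)); apply/val_inj.
- by move=> /= lti ltj; congr (inl (_, _)); apply/val_inj => /=; lia.
- by rewrite (odd_ord_eq z z').
Qed.

Lemma height_add_eq a b : (height a + height b = r.+1.*2)%N -> b = opp_index a.
Proof. by move=> ab; apply: height_inj; have := height_opp a; lia. Qed.

Lemma height_add_gt a b : (r.+1.*2 < height a + height b)%N ->
  (height (opp_index a) + height (opp_index b) < r.+1.*2)%N.
Proof. by have := height_opp a; have := height_opp b; lia. Qed.

Lemma charge_eq1 a i : charge a i = 1 -> a = inl (true, i).
Proof. by case: a => [[[] j]|z] //=; case: eqP => [->|]. Qed.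

Lemma charge_eq1_or_le0 a i : charge a i = 1 \/ charge a i <= 0.
Proof. by case: a => [[[] j]|z] /=; try case: (j == i); auto. Qed.

Lemma sum_witt_index (Z : zmodType) (f : witt_index -> Z) : \sum_a f a =
  \sum_i (f (inl (true, i)) + f (inl (false, i))) + \sum_z f (inr z).
Proof.
rewrite big_sumType /=; congr (_ + _).
transitivity (\sum_s \sum_i f (inl (s, i))).
  by rewrite pair_bigA; apply: eq_bigr => -[].
by rewrite big_bool -big_split.
Qed.

End WittIndex.

Arguments opp_indexK {r o}.
Arguments charge_inj {r o}.

Section WittBasis.
Variables (F : numFieldType) (V : vectType F) (q : {symmetric V}).
Hypothesis q_nondeg : nondegenerate q.
Variables (b2 r : nat) (r_def : r = b2./2) (dimV : \dim {:V} = (b2 + 2)%N).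
Variables (H B : {vspace 'End(V)}) (eps : 'I_r.+1 -> 'Hom(subvs_of H, F^o)).
Hypothesis datum : cartan_borel_datum q b2 B eps.

Local Notation index := (witt_index r (odd b2)).
Implicit Types (a b c d : index) (y : subvs_of H).

Definition index_weight a : 'Hom(subvs_of H, F^o) :=
  \sum_i (charge a i)%:~R *: eps i.

Lemma eps_independent (c c' : 'I_r.+1 -> F) :
  \sum_i c i *: eps i = \sum_i c' i *: eps i -> c =1 c'.
Proof.
pose X := [tuple eps i | i < r.+1]; move=> eq_cc' i.
have X_free : free X by apply: basis_free (cbd_basis datum).
have XE (j : 'I_r.+1) : X`_j = eps j by rewrite -tnth_nth tnth_mktuple.
rewrite -(coord_sum_free c i X_free) -(coord_sum_free c' i X_free).
congr (coord X i _); under eq_bigr do rewrite XE.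
by under [RHS]eq_bigr do rewrite XE.
Qed.

Lemma index_weight_inj : injective index_weight.
Proof.
move=> a b /eps_independent eq_ab; apply: charge_inj => i.
exact: (@intr_inj F) (eq_ab i).
Qed.

Lemma index_weight_opp a : index_weight (opp_index a) = - index_weight a.
Proof.
rewrite /index_weight -sumrN; apply: eq_bigr => i _.
by rewrite charge_opp mulrNz scaleNr.
Qed.

Lemma index_weight_charge a (c : 'I_r.+1 -> F) y :
  (forall i, eps i y = c i) -> index_weight a y = \sum_i (charge a i)%:~R * c i.
Proof.
move=> eps_y; rewrite sum_lfunE; apply: eq_bigr => i _.
by rewrite scale_lfunE eps_y.
Qed.

Lemma index_weight_inl (s : bool) i :
  index_weight (inl (s, i)) = if s then eps i else - eps i.
Proof.
rewrite /index_weight (bigD1 i) //= eqxx big1 => [|j /negPf ji]; last first.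
  by rewrite eq_sym ji scale0r.
by case: s; rewrite ?scaleN1r ?scale1r addr0.
Qed.

Lemma index_weight_inr z : index_weight (inr z) = 0.
Proof. by rewrite /index_weight big1 // => i _; rewrite scale0r. Qed.

Lemma card_witt_index : #|{: index}| = \dim {:V}.
Proof.
rewrite card_sum card_prod card_bool !card_ord dimV r_def.
rewrite -[in RHS](odd_double_half b2).
by lia.
Qed.

Lemma weight_vector_exists : exists v : index -> V, forall a,
  weight_vector (fun x w => x w) (index_weight a) (v a).
Proof.
suff /choice[v vP] : forall a, exists w,
    weight_vector (fun x w => x w) (index_weight a) w by exists v.
move=> a; apply/(cbd_weights datum).
case: a => [[s i]|z]; [left; exists i | right].
  by rewrite index_weight_inl; case: s; [left | right].
by rewrite index_weight_inr; split=> //; case: (odd b2) z => // -[].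
Qed.

Section Frame.
Variables (v : index -> V)
  (vP : forall a, weight_vector (fun x w => x w) (index_weight a) (v a)).

Lemma frame_neq0 a : v a != 0. Proof. exact: (vP a).1. Qed.

Lemma frame_weight a y : vsval y (v a) = index_weight a y *: v a.
Proof. exact: (vP a).2. Qed.

(** Weight vectors with distinct weights are independent, and there are
    dim V of them. *)
Lemma frame_span w : exists c : index -> F, w = \sum_a c a *: v a.
Proof.
pose n := #|{: index}|; pose X := [tuple v (enum_val (i : 'I_n)) | i < n].
have XE (i : 'I_n) : X`_i = v (enum_val i) by rewrite -tnth_nth tnth_mktuple.
have X_free : free X.
  apply/freeP => k sum0 i.
  have u0 : k i *: v (enum_val i) = 0.
    apply: (@common_eigenvectors_independent F V (subvs_of H) (fun y => vsval y)
      _ (index_enum 'I_n) (fun i y => index_weight (enum_val i) y)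
      (fun i => k i *: v (enum_val i))); last exact: mem_index_enum.
    - exact: index_enum_uniq.
    - by move=> j l _ _ eq_jl; apply/enum_val_inj/index_weight_inj/lfunP.
    - by move=> j _ y; rewrite linearZ /= frame_weight scalerA mulrC -scalerA.
    - by rewrite -[RHS]sum0; apply: eq_bigr => j _; rewrite XE.
  by move/eqP: u0; rewrite scaler_eq0 (negPf (frame_neq0 _)) orbF => /eqP.
have X_basis : basis_of fullv X.
  by rewrite basisEfree X_free subvf size_tuple /n card_witt_index leqnn.
exists (fun a => coord X (enum_rank a) w).
rewrite {1}(coord_basis X_basis (memvf w)).
rewrite (reindex _ (onW_bij _ (enum_rank_bij _))) /=.
by apply: eq_bigr => a _; rewrite XE enum_rankK.
Qed.

Lemma frame_eq (x y : 'End(V)) : (forall a, x (v a) = y (v a)) -> x = y.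
Proof.
move=> xy; apply/lfunP => w; have [c ->] := frame_span w.
by rewrite !linear_sum; apply: eq_bigr => a _; rewrite !linearZ /= xy.
Qed.

(** H preserves q. *)
Lemma frame_orth a b : b != opp_index a -> q (v a) (v b) = 0.
Proof.
move=> b_neq; apply/eqP/negPn/negP => qab; case/eqP: b_neq.
apply: index_weight_inj; rewrite index_weight_opp; apply/lfunP => y.
rewrite opp_lfunE; apply/eqP; rewrite -addr_eq0 addrC.
have yso : so q (vsval y).
  by case: (cbd_cartan datum) => [[Hso _] _ _]; apply/Hso/subvsP.
have := yso (v a) (v b).
rewrite !frame_weight linearZl_LR linearZr_LR /= -mulrDl => /eqP.
by rewrite mulf_eq0 (negPf qab) orbF.
Qed.

Definition frame_norm a := q (v a) (v (opp_index a)).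

Lemma frame_norm_opp a : frame_norm (opp_index a) = frame_norm a.
Proof. by rewrite /frame_norm opp_indexK sym_formC. Qed.

Lemma frame_norm_neq0 a : frame_norm a != 0.
Proof.
apply: contraNneq (frame_neq0 a) => norm0; apply/eqP.
apply: (nondegenerate_eq q_nondeg) => w; have [c ->] := frame_span w.
rewrite linear0l linear_sumr big1 // => b _; rewrite linearZr_LR /=.
have [->|/frame_orth ->] := eqVneq b (opp_index a); last by rewrite mulr0.
by rewrite -/(frame_norm a) norm0 mulr0.
Qed.

Definition dual_frame a := (frame_norm a)^-1 *: v (opp_index a).

Lemma dual_frameP a b : q (v a) (dual_frame b) = (a == b)%:R.
Proof.
rewrite linearZr_LR /=; have [->|ab] := eqVneq a b.
  by rewrite mulVf ?frame_norm_neq0.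
by rewrite frame_orth ?mulr0 // (can_eq opp_indexK) eq_sym.
Qed.

Lemma frame_resolves : resolves_form q v dual_frame.
Proof.
move=> x y; have [c ->] := frame_span x.
rewrite linear_sumlz /=; apply: eq_bigr => a _.
rewrite linearZl_LR linear_sumlz /= (bigD1 a) //= big1 => [|b /negPf ba].
  by rewrite linearZl_LR /= dual_frameP eqxx mulr1 addr0.
by rewrite linearZl_LR /= dual_frameP ba mulr0.
Qed.

(** For a nonzero weight it has eigenvalue 1 on v a, -1 on the vector of opposite
    weight and 0 on the rest of the basis; for the weight 0 it vanishes. *)
Definition coroot a := wedge q (v a) (dual_frame a).

Lemma coroot_so a : so q (coroot a). Proof. exact: wedge_so. Qed.

Lemma coroot_frame a b :
  coroot a (v b) = ((b == a)%:R - (b == opp_index a)%:R) *: v b.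
Proof.
rewrite wedgeE (sym_formC q (dual_frame a)) dual_frameP scalerBl.
congr (_ - _); first by case: eqVneq => [->|]; rewrite ?scale0r.
have [->|/frame_orth ->] := eqVneq b (opp_index a); last by rewrite !scale0r.
by rewrite scalerA mulfV ?frame_norm_neq0.
Qed.

(** It commutes with H, all elements being diagonal in the weight basis, and H
    is its own normalizer. *)
Lemma coroot_cartan a : coroot a \in H.
Proof.
have [_ _ H_max] := cbd_cartan datum; apply: H_max => [|y yH].
  exact: coroot_so.
rewrite (_ : lie_bracket _ y = 0) ?mem0v //; apply: frame_eq => b.
rewrite lie_bracketE zero_lfunE -(vsprojK yH) frame_weight coroot_frame.
by rewrite !linearZ /= coroot_frame frame_weight scalerN !scalerA mulrC subrr.
Qed.

Definition cartan_coroot a : subvs_of H := vsproj H (coroot a).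

Lemma cartan_corootE a : vsval (cartan_coroot a) = coroot a.
Proof. by rewrite vsprojK ?coroot_cartan. Qed.

Lemma index_weight_coroot a b :
  index_weight b (cartan_coroot a) = (b == a)%:R - (b == opp_index a)%:R.
Proof.
have := frame_weight b (cartan_coroot a); rewrite cartan_corootE coroot_frame.
move=> /eqP; rewrite -subr_eq0 -scalerBl scaler_eq0 (negPf (frame_neq0 b)) orbF.
by rewrite subr_eq0 eq_sym => /eqP.
Qed.

Lemma eps_coroot a i : eps i (cartan_coroot a) = (charge a i)%:~R.
Proof.
have := index_weight_coroot a (inl (true, i)); rewrite index_weight_inl => ->.
case: a => [[[] j]|z] /=; rewrite ?subrr ?subr0 ?sub0r //.
- by rewrite inl_eqE eq_sym; case: eqP; rewrite ?subr0.
- by rewrite inl_eqE eq_sym; case: eqP; rewrite ?oppr0.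
Qed.

Lemma eps0_check_coroot h :
  is_eps0_check eps h -> vsval h = 2 *: coroot (inl (true, ord0)).
Proof.
move=> h_def; apply: frame_eq => b.
rewrite scale_lfunE -cartan_corootE !frame_weight scalerA; congr (_ *: _).
rewrite [LHS]h_def; congr (_ * _).
rewrite (index_weight_charge b (eps_coroot _)) (bigD1 ord0) //= mulr1.
by rewrite big1 ?addr0 // => i; rewrite eq_sym => /negPf ->; rewrite mulr0.
Qed.

(** The matrix entry of x at c, d is its component on the product of the dual
    basis vectors, whose weights are opposite to those of c and d. *)
Lemma root_vector_matrix alpha x c d : so q x -> root_vector alpha x ->
  q (x (v c)) (v d) != 0 ->
  index_weight (opp_index c) + index_weight (opp_index d) = alpha.
Proof.
move=> xso [_ [_ xw]] q_neq0; apply/lfunP => y.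
rewrite add_lfunE !index_weight_opp !opp_lfunE; apply: (mulIf q_neq0).
have yso : so q (vsval y).
  by case: (cbd_cartan datum) => [[Hso _] _ _]; apply/Hso/subvsP.
have := congr1 (fun z : 'End(V) => q (z (v c)) (v d)) (xw y).
rewrite lie_bracketE scale_lfunE linearBl /= linearZl_LR /= => <-.
rewrite (so_formN _ _ yso) !frame_weight linearZr_LR linearZ linearZl_LR /=.
ring.
Qed.

Lemma frame_form_eq (x y : 'End(V)) :
  (forall c d, q (x (v c)) (v d) = q (y (v c)) (v d)) -> x = y.
Proof.
move=> xy; apply: frame_eq => c; apply: (nondegenerate_eq q_nondeg) => w.
have [k ->] := frame_span w; rewrite !linear_sumr; apply: eq_bigr => d _.
by rewrite !linearZr_LR /= xy.
Qed.

Lemma wedge_frame_matrix a b c d :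
  q (wedge q (v a) (v b) (v c)) (v d) =
    q (v b) (v c) * q (v a) (v d) - q (v a) (v c) * q (v b) (v d).
Proof. by rewrite wedgeE linearBl /= !linearZl_LR. Qed.

(** This makes root spaces one-dimensional. The coefficient of eps_i in the sum
    is 1, and eps_i is the only weight of V where it is positive. *)
Lemma root_index_unique i b c d :
    b != inl (true, i) -> b != inl (false, i) ->
    index_weight c + index_weight d =
      index_weight (inl (true, i)) + index_weight b ->
  (c = inl (true, i) /\ d = b) \/ (c = b /\ d = inl (true, i)).
Proof.
move=> ba bna eq_wt.
have ch j : charge c j + charge d j =
    charge (inl (true, i) : index) j + charge b j.
  apply/(@intr_inj F); rewrite !rmorphD /=; move: j.
  apply: eps_independent; under eq_bigr do rewrite scalerDl.
  under [RHS]eq_bigr do rewrite scalerDl.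
  by rewrite !big_split.
have bi0 : charge b i = 0.
  case: b ba bna {eq_wt ch} => [[s j]|//] ba bna.
  rewrite /charge; have [ji|//] := eqVneq j i.
  by case: s ba bna; rewrite ji eqxx.
have chi := ch i; rewrite bi0 /= eqxx addr0 in chi.
have [ci|ci] := charge_eq1_or_le0 c i.
  have c_eq := charge_eq1 ci; left; split=> //; apply: charge_inj => j.
  by have := ch j; rewrite c_eq => /addrI.
have [di|di] := charge_eq1_or_le0 d i; last by lia.
have d_eq := charge_eq1 di; right; split=> //; apply: charge_inj => j.
by have := ch j; rewrite d_eq addrC => /addrI.
Qed.

(** An element of so(V, q) is determined by its antisymmetric matrix in the
    weight basis, where both sides are supported on the same pair of indices. *)
Lemma root_vector_wedge i b x :
    b != inl (true, i) -> b != inl (false, i) -> so q x ->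
    root_vector (index_weight (inl (true, i)) + index_weight b) x ->
  exists2 t, t != 0 & x = t *: wedge q (v (inl (true, i))) (v b).
Proof.
set a : index := inl (true, i) => ba bna xso x_root.
have x_neq0 : x != 0 by case: x_root => _ [].
have support c d : q (x (v c)) (v d) != 0 ->
    (c = opp_index a /\ d = opp_index b) \/
    (c = opp_index b /\ d = opp_index a).
  move=> q_neq0.
  have [[ca db]|[cb da]] :=
    root_index_unique ba bna (root_vector_matrix xso x_root q_neq0).
  - by left; rewrite /a -ca -db !opp_indexK.
  - by right; rewrite /a -cb -da !opp_indexK.
have ab : opp_index a != opp_index b by rewrite (can_eq opp_indexK) eq_sym.
have qab : q (v a) (v (opp_index b)) = 0 by apply: frame_orth; rewrite eq_sym.
have qba : q (v b) (v (opp_index a)) = 0 by apply: frame_orth.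
pose m := q (x (v (opp_index a))) (v (opp_index b)).
have xE : x = (- m / (frame_norm a * frame_norm b)) *: wedge q (v a) (v b).
  apply: frame_form_eq => c d.
  rewrite scale_lfunE linearZl_LR /= wedge_frame_matrix.
  have nn : frame_norm a * frame_norm b != 0.
    by rewrite mulf_neq0 ?frame_norm_neq0.
  have [[-> ->]|not1] := pselect (c = opp_index a /\ d = opp_index b).
    rewrite qab mulr0 sub0r -/(frame_norm a) -/(frame_norm b) -/m.
    by rewrite mulrN mulNr mulNr opprK mulfVK.
  have [[-> ->]|not2] := pselect (c = opp_index b /\ d = opp_index a).
    rewrite qab mul0r subr0 -/(frame_norm a) -/(frame_norm b).
    rewrite so_formN // sym_formC -/m [frame_norm b * _]mulrC.
    by rewrite mulfVK.
  have [q0|/support[]//] := eqVneq (q (x (v c)) (v d)) 0.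
  rewrite q0; have [cb|/frame_orth ->] := eqVneq c (opp_index b); last first.
    have [ca|/frame_orth ->] := eqVneq c (opp_index a);
      last by rewrite !mul0r subr0 mulr0.
    have [db|/frame_orth ->] := eqVneq d (opp_index b); first by case: not1.
    by rewrite mul0r mulr0 subr0 mulr0.
  have [da|/frame_orth ->] := eqVneq d (opp_index a); first by case: not2.
  by rewrite cb qab mul0r mulr0 subr0 mulr0.
exists (- m / (frame_norm a * frame_norm b)) => //.
by apply: contraNneq x_neq0 => t0; rewrite xE t0 scale0r.
Qed.

(** Only a root vector of unknown shape is available in B; it is identified by
    [root_vector_wedge]. *)
Lemma positive_root_vector (i : 'I_r.+1) b :
    (i + height b < r.+1.*2)%N -> b != inl (true, i) ->
  exists2 x, x \in B &
    root_vector (index_weight (inl (true, i)) + index_weight b) x.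
Proof.
move=> hib ba; apply/(cbd_roots datum).
rewrite index_weight_inl; case: b hib ba => [[[] j]|z] /= hij ba; last first.
- right; split; last by exists i; rewrite index_weight_inr addr0.
  by case: (odd b2) z {hij ba} => // -[].
- left; exists i, j; rewrite index_weight_inl; split; last by left.
  by have := ltn_ord j; lia.
left; rewrite index_weight_inl; case: (ltngtP i j) => [ij|ji|/val_inj eq_ij].
- by exists i, j; split=> //; right.
- by exists j, i; split=> //; right; rewrite addrC.
- by rewrite eq_ij eqxx in ba.
Qed.

Section HighestWeight.
Variables (W : vectType F) (rho : 'End(V) -> 'End(W)).
Hypothesis rho_mod : so_module q rho.
Variables (mu : 'I_r.+1 -> rat) (w : W).
Hypothesis w_weight : forall y, rho (vsval y) w = weight_of eps mu y *: w.
Hypothesis w_highest :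
  forall (alpha : 'Hom(subvs_of H, F^o)) x, x \in B ->
    root_vector alpha x -> rho x w = 0.

Definition index_value a : rat := \sum_i mu i * (charge a i)%:~R.

Lemma coroot_highest a : rho (coroot a) w = ratr (index_value a) *: w.
Proof.
rewrite -cartan_corootE w_weight sum_lfunE rmorph_sum /=; congr (_ *: _).
apply: eq_bigr => i _; rewrite scale_lfunE eps_coroot.
by rewrite rmorphM /= ratr_int.
Qed.

Lemma positive_wedge_highest a b :
  (height a + height b < r.+1.*2)%N -> a != b ->
  rho (wedge q (v a) (v b)) w = 0.
Proof.
have kill (i : 'I_r.+1) c : (i + height c < r.+1.*2)%N -> c != inl (true, i) ->
    rho (wedge q (v (inl (true, i))) (v c)) w = 0.
  move=> hic c_neq; have [x xB x_root] := positive_root_vector hic c_neq.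
  have xso : so q x by case: (cbd_borel datum) => [[Bso _] _ _]; apply: Bso.
  have c_neq' : c != inl (false, i).
    by apply: contraTneq hic => ->; have := ltn_ord i; rewrite /=; lia.
  have [t t0 xE] := root_vector_wedge c_neq c_neq' xso x_root.
  have /eqP := w_highest xB x_root.
  rewrite xE (so_moduleZ rho_mod); last exact: wedge_so.
  by rewrite scale_lfunE scaler_eq0 (negPf t0) => /eqP.
case: a => [[[] i]|z] hab ab; first by apply: kill; rewrite // eq_sym.
- case: b hab ab => [[[] j]|z] /= hab ab;
    try by have := ltn_ord i; try have := ltn_ord j; lia.
  rewrite wedgeC -scaleN1r (so_moduleZ rho_mod); last exact: wedge_so.
  by rewrite scale_lfunE kill ?scaler0 //= addnC.
- case: b hab ab => [[[] j]|z'] /= hab ab; try by try have := ltn_ord j; lia.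
  rewrite wedgeC -scaleN1r (so_moduleZ rho_mod); last exact: wedge_so.
  by rewrite scale_lfunE kill ?scaler0 //= addnC.
Qed.

(** The eigenvalue of the (a, b) term of the Casimir operator on a highest
    weight vector. *)
Definition casimir_coef a b : rat :=
  if a == b then 0
  else if (height a + height b < r.+1.*2)%N then index_value a + index_value b
  else if b == opp_index a then index_value a ^+ 2 else 0.

Lemma dual_wedge a b : wedge q (dual_frame b) (dual_frame a) =
  (frame_norm a * frame_norm b)^-1 *:
    wedge q (v (opp_index b)) (v (opp_index a)).
Proof. by rewrite wedgeZl wedgeZr scalerA invfM mulrC. Qed.

(** For a positive root v a ^ v b kills w, and the term is the action of the
    bracket, which is the coroot. For a negative root the right factor kills w.
    For opposite indices both factors are multiples of a coroot. *)
Lemma casimir_term_highest a b :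
  rho (wedge q (v a) (v b)) (rho (wedge q (dual_frame b) (dual_frame a)) w) =
  ratr (casimir_coef a b) *: w.
Proof.
rewrite /casimir_coef; have [->|ab] := eqVneq a b.
  by rewrite wedgevv (so_module0 rho_mod) zero_lfunE rmorph0 scale0r.
case: ltngtP => [hab|hab|/height_add_eq ->].
- have brE : lie_bracket (wedge q (v a) (v b))
      (wedge q (dual_frame b) (dual_frame a)) = coroot a + coroot b.
    rewrite lie_bracket_wedge; last exact: wedge_so.
    rewrite !wedgeE !dual_frameP !eqxx [b == a]eq_sym (negPf ab).
    rewrite !scale1r !scale0r !subr0 sub0r; congr (_ + _).
    by rewrite -[- v b]scaleN1r wedgeZr scaleN1r -wedgeC.
  have := congr1 (fun x => rho x w) brE.
  rewrite /= rho_mod.2; try exact: wedge_so.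
  rewrite lie_bracketE (positive_wedge_highest hab ab) linear0 subr0 => ->.
  rewrite -[coroot a]scale1r rho_mod.1; try exact: coroot_so.
  by rewrite scale1r add_lfunE !coroot_highest -scalerDl rmorphD.
- have b_opp : (b == opp_index a) = false.
    by apply: contraTF hab => /eqP ->; rewrite addnC height_opp ltnn.
  rewrite b_opp rmorph0 scale0r dual_wedge.
  rewrite (so_moduleZ rho_mod); last exact: wedge_so.
  rewrite scale_lfunE positive_wedge_highest ?scaler0 ?linear0 //.
    by rewrite addnC height_add_gt.
  by rewrite (can_eq opp_indexK) eq_sym.
- rewrite eqxx /dual_frame opp_indexK frame_norm_opp.
  have -> : wedge q ((frame_norm a)^-1 *: v a) (dual_frame a) =
      (frame_norm a)^-1 *: coroot a by rewrite wedgeZl.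
  have -> : wedge q (v a) (v (opp_index a)) = frame_norm a *: coroot a.
    by rewrite /coroot wedgeZr scalerA mulfV ?frame_norm_neq0 // scale1r.
  rewrite !(so_moduleZ rho_mod); try exact: coroot_so.
  rewrite !scale_lfunE coroot_highest !linearZ /= coroot_highest !scalerA.
  congr (_ *: w); rewrite rmorphXn /=; field; exact: frame_norm_neq0.
Qed.

Lemma casimir_highest :
  casimir q rho v dual_frame w = ratr (\sum_a \sum_b casimir_coef a b) *: w.
Proof.
rewrite sum_lfunE rmorph_sum scaler_suml; apply: eq_bigr => a _.
rewrite sum_lfunE rmorph_sum scaler_suml; apply: eq_bigr => b _.
by rewrite comp_lfunE casimir_term_highest.
Qed.

End HighestWeight.

(** The hyperbolic planes spanned by the weight vectors of opposite weights are
    diagonalized; norms 2 and -2 avoid square roots. *)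
Definition orth_frame (a : index) : V :=
  match a with
  | inl (true, i) => v (inl (true, i)) + dual_frame (inl (true, i))
  | inl (false, i) => v (inl (true, i)) - dual_frame (inl (true, i))
  | inr z => v (inr z)
  end.

Lemma frame_form_pair i j :
  [/\ q (v (inl (true, i))) (v (inl (true, j))) = 0,
      q (dual_frame (inl (true, i))) (dual_frame (inl (true, j))) = 0
    & q (v (inl (true, i))) (dual_frame (inl (true, j))) = (i == j)%:R].
Proof.
split; first exact: frame_orth.
  by rewrite linearZl_LR linearZr_LR /= frame_orth ?mulr0.
by rewrite dual_frameP inl_eqE.
Qed.

Lemma frame_form_zero i z :
  q (v (inl (true, i))) (v (inr z)) = 0 /\
  q (dual_frame (inl (true, i))) (v (inr z)) = 0.
Proof. by rewrite linearZl_LR /= !frame_orth ?mulr0. Qed.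

Lemma orth_frame_orth a b : a != b -> q (orth_frame a) (orth_frame b) = 0.
Proof.
case: a b => [[s i]|z] [[t j]|z']; last by rewrite (odd_ord_eq z z') eqxx.
- have [q1 q2 q3] := frame_form_pair i j; have [_ _ q4] := frame_form_pair j i.
  move=> ij; case: s t ij => [] [] ij /=;
  rewrite !(linearDl, linearDr, linearNl, linearNr) /= q1 q2 q3
    (sym_formC q (dual_frame _)) q4 (eq_sym j i);
  case: (i =P j) ij => [->|_]; rewrite ?eqxx //= => _; ring.
- have [q1 q2] := frame_form_zero i z'.
  by case: s => _ /=; rewrite !(linearDl, linearNl) /= q1 q2 ?oppr0 addr0.
- have [q1 q2] := frame_form_zero j z; rewrite sym_formC.
  by case: t => _ /=; rewrite !(linearDl, linearNl) /= q1 q2 ?oppr0 addr0.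
Qed.

Lemma orth_frame_norm a : q (orth_frame a) (orth_frame a) =
  match a with
  | inl (s, _) => if s then 2 else - 2
  | inr z => frame_norm (inr z)
  end.
Proof.
case: a => [[s i]|z] //; have [q1 q2 q3] := frame_form_pair i i.
by case: s => /=; rewrite !(linearDl, linearDr, linearNl, linearNr) /= q1 q2
  (sym_formC q (dual_frame _)) q3 eqxx /= mulr1n; ring.
Qed.

Lemma orth_frame_norm_neq0 a : q (orth_frame a) (orth_frame a) != 0.
Proof.
rewrite orth_frame_norm; case: a => [[[] i]|z]; last exact: frame_norm_neq0.
- by rewrite pnatr_eq0.
- by rewrite oppr_eq0 pnatr_eq0.
Qed.

Definition orth_dual a : V :=
  (q (orth_frame a) (orth_frame a))^-1 *: orth_frame a.

Lemma orth_frame_resolves : resolves_form q orth_frame orth_dual.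
Proof.
move=> x y; rewrite (frame_resolves x y) !sum_witt_index; congr (_ + _).
apply: eq_bigr => i _; rewrite /orth_dual !orth_frame_norm !linearZr_LR /=.
rewrite !linearDl !linearDr !linearNl !linearNr /=.
have nE : frame_norm (inl (false, i)) = frame_norm (inl (true, i)).
  exact: (frame_norm_opp (inl (true, i))).
rewrite /dual_frame nE /= !linearZr_LR !linearZl_LR /=.
field.
exact: frame_norm_neq0.
Qed.

(** The two basis vectors from the i-th hyperbolic plane have norms 2 and -2 and
    wedge -2 times the coroot, so that the factors cancel up to a sign. *)
Lemma casimir_trace_coroot (W : vectType F) (rho : 'End(V) -> 'End(W)) i :
  so_module q rho ->
  lfun_trace (casimir q rho v dual_frame) =
    ((b2 + 2) * (b2 + 1))%:R *
    lfun_trace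
      (rho (coroot (inl (true, i))) \o rho (coroot (inl (true, i))))%VF.
Proof.
move=> rho_mod.
rewrite (casimir_basis_free q_nondeg rho_mod frame_resolves
  orth_frame_resolves).
rewrite (@casimir_trace _ _ q _ rho rho_mod _ _ orth_frame_orth
  orth_frame_norm_neq0 (inl (true, i)) (inl (false, i))) //.
rewrite !orth_frame_norm card_witt_index dimV addn2 addn1 /=.
rewrite wedge_sum_diff -/(coroot _).
rewrite (so_moduleZ rho_mod); last exact: wedge_so.
rewrite -comp_lfunZl -comp_lfunZr !linearZ /=.
by field; rewrite ?pnatr_eq0.
Qed.

End Frame.
End WittBasis.

(** * The Casimir eigenvalue *)

Section CasimirSum.
Variables (b2 r : nat) (r_def : r = b2./2) (mu : 'I_r.+1 -> rat).

Local Notation index := (witt_index r (odd b2)).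

Lemma index_value_inl (s : bool) i :
  index_value mu (inl (s, i) : index) = if s then mu i else - mu i.
Proof.
rewrite /index_value (bigD1 i) //= eqxx big1 => [|j /negPf ji]; last first.
  by rewrite eq_sym ji mulr0.
by case: s; rewrite ?mulrN1 ?mulr1 addr0.
Qed.

Lemma index_value_inr z : index_value mu (inr z : index) = 0.
Proof. by rewrite /index_value big1 // => i _; rewrite mulr0. Qed.

Let cc a b : rat := @casimir_coef b2 r mu a b.

(** For i < j the roots eps_i + eps_j and eps_i - eps_j together contribute
    2 mu_i; for i = j only the pairs of opposite weights remain. *)
Lemma casimir_coef_inl i j :
  cc (inl (true, i)) (inl (true, j)) + cc (inl (true, i)) (inl (false, j)) +
  (cc (inl (false, i)) (inl (true, j)) + cc (inl (false, i)) (inl (false, j))) =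
  (i < j)%N%:R * (2 * mu i) + (j < i)%N%:R * (2 * mu j) +
  (if j == i then 2 * mu i ^+ 2 else 0).
Proof.
have lti := ltn_ord i; have ltj := ltn_ord j.
rewrite /cc /casimir_coef !index_value_inl /=.
rewrite !inl_eqE.
rewrite (_ : (i + j < r.+1.*2)%N = true); last by lia.
rewrite (_ : (i + (r.+1.*2 - j) < r.+1.*2)%N = (i < j)%N); last by lia.
rewrite (_ : (r.+1.*2 - i + j < r.+1.*2)%N = (j < i)%N); last by lia.
rewrite (_ : (r.+1.*2 - i + (r.+1.*2 - j) < r.+1.*2)%N = false); last by lia.
rewrite (eq_sym j i); have [<-|ij] := eqVneq i j.
  by rewrite ltnn /=; ring.
have ij' : (i : nat) != j by [].
by case: ltngtP ij' => //= _ _; ring.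
Qed.

Lemma casimir_coef_inr i z :
  cc (inl (true, i)) (inr z) + cc (inl (false, i)) (inr z) = mu i /\
  cc (inr z) (inl (true, i)) + cc (inr z) (inl (false, i)) = mu i.
Proof.
have lti := ltn_ord i.
rewrite /cc /casimir_coef !index_value_inl index_value_inr /=.
rewrite (_ : (i + r.+1 < r.+1.*2)%N = true); last by lia.
rewrite (_ : (r.+1 + i < r.+1.*2)%N = true); last by lia.
rewrite (_ : (r.+1.*2 - i + r.+1 < r.+1.*2)%N = false); last by lia.
rewrite (_ : (r.+1 + (r.+1.*2 - i) < r.+1.*2)%N = false); last by lia.
by rewrite !addr0 add0r.
Qed.

Lemma sum_ltn_ord (i n : nat) : (\sum_(j < n) (i < j) = n - i.+1)%N.
Proof.
by elim: n => [|n IHn]; rewrite ?big_ord0 // big_ord_recr /= IHn; lia.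
Qed.

Lemma casimir_coef_sum : \sum_a \sum_b cc a b =
  2 * ((\sum_i mu i) * b2%:R +
       \sum_i ((mu i - (i : nat)%:R) ^+ 2 - (i : nat)%:R ^+ 2)).
Proof.
have inr0 (z z' : 'I_(odd b2)) : cc (inr z) (inr z') = 0.
  by rewrite /cc /casimir_coef (odd_ord_eq z z') eqxx.
have upper : \sum_(i < r.+1) \sum_(j < r.+1) (i < j)%N%:R * (2 * mu i) =
    \sum_(i < r.+1) (r - i)%:R * (2 * mu i).
  apply: eq_bigr => i _; rewrite -mulr_suml -natr_sum sum_ltn_ord.
  by rewrite subSS.
rewrite sum_witt_index.
under eq_bigr => i _ do rewrite !sum_witt_index.
under [X in _ + X]eq_bigr => z _ do rewrite sum_witt_index.
transitivity (\sum_(i < r.+1) (2 * ((r - i)%:R * (2 * mu i)) + 2 * mu i ^+ 2 +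
    (odd b2)%:R * (2 * mu i))); last first.
  rewrite mulr_suml -big_split mulr_sumr /=; apply: eq_bigr => i _.
  rewrite -[in RHS](odd_double_half b2) -r_def natrD -muln2 natrM.
  rewrite natrB; last exact: (ltn_ord i).
  by ring.
rewrite (eq_bigr (fun i : 'I_r.+1 =>
    \sum_(j < r.+1) ((i < j)%N%:R * (2 * mu i) +
      (j < i)%N%:R * (2 * mu j) + (if j == i then 2 * mu i ^+ 2 else 0)) +
    (odd b2)%:R * mu i)); last first.
  move=> i _; rewrite addrACA -!big_split /=; congr (_ + _).
    by apply: eq_bigr => j _; rewrite casimir_coef_inl.
  rewrite (eq_bigr (fun=> mu i)); last first.
    by move=> z _; have [] := casimir_coef_inr i z.
  by rewrite sumr_const card_ord mulr_natl.
rewrite [X in _ + X](eq_bigr (fun=> \sum_i mu i)); last first.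
  move=> z _; rewrite [X in _ + X]big1 ?addr0 //.
  by apply: eq_bigr => i _; have [] := casimir_coef_inr i z.
rewrite sumr_const card_ord !big_split /=.
under eq_bigr do rewrite !big_split /=.
rewrite !big_split /= [X in _ + X + _ + _ + _]exchange_big upper.
rewrite [X in _ + X + _ + _](eq_bigr (fun i => 2 * mu i ^+ 2)); last first.
  by move=> i _; rewrite -big_mkcond big_pred1_eq.
by rewrite -!mulr_sumr; ring.
Qed.

End CasimirSum.

(** * The constant s as a trace *)

Section IntegralEigenvalues.
Variables (F : numFieldType) (W : vectType F) (f : 'End(W)).

Lemma h_part_dim (s : seq int) : uniq s ->
  \dim (\sum_(k <- s) h_part f k) = (\sum_(k <- s) \dim (h_part f k))%N.
Proof.
move=> s_uniq; rewrite (big_nth 0) [in RHS](big_nth 0) !big_mkord.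
apply/directvP/leigenspaces_direct => i j /intr_inj/eqP.
by rewrite nth_uniq // => /eqP/val_inj.
Qed.

(** The sum is taken over a finite set of integers for which its dimension is
    maximal; this spares a bound for the eigenvalues. *)
Lemma maximal_h_parts (P : int -> Prop) : exists s : seq int,
  [/\ uniq s, forall k, k \in s -> P k
    & forall k, P k -> (h_part f k <= \sum_(j <- s) h_part f j)%VS].
Proof.
pose Q n := `[< exists s : seq int, [/\ uniq s, forall k, k \in s -> P k
  & \dim (\sum_(k <- s) h_part f k) = n] >].
have exQ : exists n, Q n.
  by exists 0; apply/asboolP; exists [::]; rewrite big_nil dimv0.
have ubQ n : Q n -> (n <= \dim {:W})%N.
  by move=> /asboolP[s [_ _ <-]]; apply/dimvS/subvf.
have [n /asboolP[s [s_uniq sP dim_s]] n_max] := ex_maxnP exQ ubQ.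
exists s; split=> // k Pk; have [ks|ks] := boolP (k \in s).
  by rewrite (big_rem k) //= addvSl.
have /n_max : Q (\dim (\sum_(j <- k :: s) h_part f j)).
  apply/asboolP; exists (k :: s); split=> //=; first by rewrite ks.
  by move=> j; rewrite inE => /orP[/eqP->|/sP].
rewrite -dim_s => dim_le.
apply: subv_trans (addvSl _ (\sum_(j <- s) h_part f j)) _.
rewrite big_cons in dim_le.
have /eqP <- : (\sum_(j <- s) h_part f j ==
    h_part f k + \sum_(j <- s) h_part f j)%VS by rewrite eqEdim addvSr.
exact: subvv.
Qed.

(** All k in s have the parity of m, so that (-1)^m factors out of both sums. *)
Lemma s_const_trace (m : int) (s : seq int) :
  uniq s -> (forall k, k \in s -> exists j, k = m + 2 * j) ->
  (\sum_(k <- s) h_part f k)%VS = fullv -> \dim {:W} != 0%N ->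
  ratr (s_const f) = lfun_trace (f \o f)%VF / (\dim {:W})%:R.
Proof.
move=> s_uniq s_par sumW dimW.
have out k : k \notin s -> \dim (h_part f k) = 0%N.
  (* the eigenspaces for s already exhaust W *)
  move=> ks; have := h_part_dim (s := k :: s); rewrite /= ks s_uniq => /(_ isT).
  rewrite !big_cons -(h_part_dim s_uniq) sumW => dim_eq.
  have := dimvS (subvf (h_part f k + fullv)); rewrite dim_eq.
  by rewrite -[X in (_ <= X)%N]add0n leq_add2r leqn0 => /eqP.
have sign k : k \in s -> (-1) ^ k = (-1) ^ m :> rat.
  move=> /s_par[j ->]; rewrite expfzDr // -exprz_exp.
  by rewrite (_ : (-1) ^ 2 = 1) ?exp1rz ?mulr1.
have fsum (G : int -> rat) : (forall k, k \notin s -> G k = 0) ->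
    \sum_(k \in [set: int]%classic) G k = \sum_(k <- s) G k.
  move=> G0; rewrite (fsbigE s) //; last by move=> k _; apply: G0.
  by apply: eq_bigl => k; rewrite in_setT.
have num : \sum_(k \in [set: int]%classic)
     ((-1) ^ k * k%:~R ^+ 2 * (\dim (h_part f k))%:R : rat) =
   (-1) ^ m * \sum_(k <- s) k%:~R ^+ 2 * (\dim (h_part f k))%:R.
  rewrite fsum; last by move=> k /out ->; rewrite mulr0.
  by rewrite mulr_sumr; apply: eq_big_seq => k ks; rewrite sign ?mulrA.
have den : \sum_(k \in [set: int]%classic)
     ((-1) ^ k * (\dim (h_part f k))%:R : rat) =
   (-1) ^ m * (\dim {:W})%:R.
  rewrite fsum; last by move=> k /out ->; rewrite mulr0.
  rewrite -sumW h_part_dim // natr_sum mulr_sumr.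
  by apply: eq_big_seq => k ks; rewrite sign.
rewrite /s_const num den -mulf_div divff ?mul1r; last by rewrite expfz_neq0.
rewrite fmorph_div /= ratr_nat; congr (_ / _).
have trE := @lfun_trace_sqr_diagonalizable F W f (size s) (fun i => (s`_i)%:~R).
rewrite trE; first last.
- by rewrite -sumW (big_nth 0) big_mkord.
- move=> i j /intr_inj/eqP; rewrite nth_uniq // => /eqP; exact: val_inj.
rewrite (big_nth 0) big_mkord rmorph_sum; apply: eq_bigr => i _.
by rewrite rmorphM rmorphXn /= ratr_int ratr_nat.
Qed.

End IntegralEigenvalues.

(** * Irreducible highest weight modules *)

Section HighestWeightModule.
Variables (F : numFieldType) (V : vectType F) (q : {symmetric V}).
Hypothesis q_nondeg : nondegenerate q.
Variables (b2 r : nat) (r_def : r = b2./2) (dimV : \dim {:V} = (b2 + 2)%N).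
Variables (H B : {vspace 'End(V)}) (eps : 'I_r.+1 -> 'Hom(subvs_of H, F^o)).
Hypothesis datum : cartan_borel_datum q b2 B eps.
Variables (h : subvs_of H) (h_def : is_eps0_check eps h).
Variables (W : vectType F) (rho : 'End(V) -> 'End(W)).
Hypothesis W_irr : irreducible_so_module q rho.

Lemma irreducible_full (U : {vspace W}) w : w \in U -> w != 0 ->
  (forall x u, so q x -> u \in U -> rho x u \in U) -> U = fullv.
Proof.
move=> wU w0 U_stable; have [_ _ irr] := W_irr.
have [x xso||//] := irr U; last by move=> U0; rewrite U0 memv0 (negPf w0) in wU.
by apply/subvP => _ /memv_imgP[u uU ->]; apply: U_stable.
Qed.

(** Schur's lemma, with the eigenvalue given by one eigenvector. *)
Lemma central_scalar (C : 'End(W)) c w :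
  (forall x, so q x -> lie_bracket (rho x) C = 0) -> w != 0 -> C w = c *: w ->
  C = c *: \1%VF.
Proof.
move=> C_central w0 Cw.
have full : passmx.leigenspace C c = fullv.
  apply: (@irreducible_full _ w) => // [|x u xso].
    by rewrite memv_leigenspace Cw.
  rewrite !memv_leigenspace => /eqP Cu; apply/eqP.
  have /eqP := congr1 (fun f : 'End(W) => f u) (C_central x xso).
  by rewrite lie_bracketE zero_lfunE Cu linearZ subr_eq0 eq_sym => /eqP.
apply/lfunP => u; rewrite scale_lfunE id_lfunE; apply/eqP.
by rewrite -memv_leigenspace full memvf.
Qed.

(** Elements of so(V, q) are sums of v a ^ v b, which shift the eigenvalues of h
    by even integers; so the sum of the eigenspaces for the integers
    congruent to m modulo 2 is a submodule. *)
Lemma h_parts_full (m : int) w : w != 0 -> rho (vsval h) w = m%:~R *: w ->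
  exists s : seq int, [/\ uniq s, forall k, k \in s -> exists j, k = m + 2 * j
    & (\sum_(k <- s) h_part (rho (vsval h)) k)%VS = fullv].
Proof.
move=> w0 hw; have [rho_mod _ _] := W_irr.
have [v vP] := weight_vector_exists datum.
have res := frame_resolves q_nondeg r_def dimV datum vP.
have hso : so q (vsval h).
  by case: (cbd_cartan datum) => [[Hso _] _ _]; apply/Hso/subvsP.
have h_v a : vsval h (v a) = (2 * charge a ord0)%:~R *: v a.
  rewrite (frame_weight vP) [index_weight _ _ _]h_def; congr (_ *: _).
  by rewrite intrM.
pose P k := exists j, k = m + 2 * j.
have [s [s_uniq sP s_max]] := maximal_h_parts (rho (vsval h)) P.
exists s; split=> //; set U := (\sum_(k <- s) _)%VS.
have shift a b k u : P k -> u \in h_part (rho (vsval h)) k ->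
    rho (wedge q (v a) (v b)) u \in U.
  move=> [j kE]; rewrite memv_leigenspace => /eqP hu.
  have Pk' : P (k + 2 * (charge a ord0 + charge b ord0)).
    by exists (j + (charge a ord0 + charge b ord0)); rewrite kE; ring.
  apply: (subvP (s_max _ Pk')); rewrite memv_leigenspace; apply/eqP.
  have := congr1 (fun x => rho x u) (lie_bracket_wedge (v a) (v b) hso).
  rewrite !h_v wedgeZl wedgeZr -scalerDl.
  rewrite rho_mod.2 ?(so_moduleZ rho_mod) //; try exact: wedge_so.
  rewrite lie_bracketE hu linearZ scale_lfunE /= => /eqP.
  rewrite subr_eq -scalerDl => /eqP ->; congr (_ *: _).
  by rewrite -!rmorphD /=; congr (_ %:~R); ring.
have wedgeU a b u : u \in U -> rho (wedge q (v a) (v b)) u \in U.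
  move=> uU; have : rho (wedge q (v a) (v b)) u \in
      (rho (wedge q (v a) (v b)) @: U)%VS by apply: memv_img.
  apply: subvP; rewrite limg_sum big_seq.
  apply: (big_ind (fun X => X <= U)%VS); first exact: sub0v.
    by move=> X Y XU YU; rewrite subv_add XU.
  move=> k ks; apply/subvP => _ /memv_imgP[u' u'k ->].
  exact: (shift a b k u' (sP k ks)).
apply: (irreducible_full (w := w)) => // [|x u xso uU].
  apply: (subvP (s_max m _)); first by exists 0; rewrite mulr0 addr0.
  by rewrite memv_leigenspace hw.
have : 2 *: rho x u \in U.
  rewrite -scale_lfunE -(so_moduleZ rho_mod) //.
  rewrite (so_wedge_span q_nondeg res xso).
  rewrite (so_module_sum rho_mod); last by move=> a; apply: wedge_so.
  rewrite sum_lfunE rpred_sum // => a _.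
  rewrite wedgeZr (so_moduleZ rho_mod) ?scale_lfunE ?rpredZ //;
    last exact: wedge_so.
  rewrite (resolves_form_expand q_nondeg res (x (v a))).
  rewrite (linear_lincomb (wedge_linearl q _)) (so_module_sum rho_mod);
    last first.
    by move=> b; apply/so_scale/wedge_so.
  rewrite sum_lfunE rpred_sum // => b _.
  rewrite (so_moduleZ rho_mod) ?scale_lfunE ?rpredZ ?wedgeU //.
  exact: wedge_so.
by move=> /(rpredZ 2^-1); rewrite scalerA mulVf ?scale1r // pnatr_eq0.
Qed.

Lemma s_const_highest_weight (mu : 'I_r.+1 -> rat) (m : int) :
  has_highest_weight B rho (weight_of eps mu) -> 2 * mu ord0 = m%:~R ->
  s_const (rho (vsval h)) =
    8 * (((\sum_i mu i) * b2%:R +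
          \sum_i ((mu i - (i : nat)%:R) ^+ 2 - (i : nat)%:R ^+ 2)) /
         ((b2%:R + 1) * (b2%:R + 2))).
Proof.
move=> [w [[w0 w_weight] w_highest]] mu0; have [rho_mod dimW _] := W_irr.
have [v vP] := weight_vector_exists datum.
have hw : rho (vsval h) w = m%:~R *: w.
  by rewrite w_weight [weight_of _ _ _]h_def -ratr_int -mu0 rmorphM /= ratr_nat.
have [s [s_uniq s_par sumW]] := h_parts_full w0 hw.
have res := frame_resolves q_nondeg r_def dimV datum vP.
pose C := casimir q rho v (dual_frame q v).
set S := (_ + \sum_i _ in RHS).
have CE : C = ratr (2 * S) *: \1%VF.
  apply: central_scalar w0 _; first by move=> x; apply: casimir_invariant.
  rewrite /C.
  rewrite (casimir_highest q_nondeg r_def dimV datum vP rho_mod w_weight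
    w_highest).
  by rewrite casimir_coef_sum.
pose t := lfun_trace (rho (coroot q v (inl (true, ord0))) \o
                      rho (coroot q v (inl (true, ord0))))%VF.
have trC : ratr (2 * S) * (\dim {:W})%:R = ((b2 + 2) * (b2 + 1))%:R * t.
  rewrite -(casimir_trace_coroot q_nondeg r_def dimV datum vP ord0 rho_mod) -/C.
  by rewrite CE linearZ /= lfun_trace1.
have trh : lfun_trace (rho (vsval h) \o rho (vsval h))%VF = 4 * t.
  rewrite (eps0_check_coroot q_nondeg r_def dimV datum vP h_def).
  rewrite (so_moduleZ rho_mod); last exact: wedge_so.
  by rewrite -comp_lfunZl -comp_lfunZr !linearZ /= mulrA -natrM.
apply: (fmorph_inj (@ratr F)).
rewrite [LHS](s_const_trace s_uniq s_par sumW dimW) trh.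
have dim_neq0 : (\dim {:W})%:R != 0 :> F by rewrite pnatr_eq0.
have n1 : b2%:R + 1 != 0 :> F by rewrite -(natrD F b2 1) pnatr_eq0 addn1.
have n2 : b2%:R + 2 != 0 :> F by rewrite -(natrD F b2 2) pnatr_eq0 addn2.
have tE : t = ratr (2 * S) * (\dim {:W})%:R / ((b2%:R + 1) * (b2%:R + 2)).
  rewrite trC natrM !natrD; field; by rewrite n1 n2.
rewrite tE !rmorphM /= fmorphV rmorphM !rmorphD /= !ratr_nat rmorph1.
field; by rewrite n1 n2 dim_neq0.
Qed.

End HighestWeightModule.

Theorem theorem3p5 (R : realType) (b2 r : nat) (b2_ge3 : (3 <= b2)%N)
    (r_def : r = b2./2)
    (V : vectType R[i]) (dimV : \dim {:V} = (b2 + 2)%N)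
    (q : {symmetric V}) (q_nondeg : nondegenerate q)
    (H B : {vspace 'End(V)}) (eps : 'I_r.+1 -> 'Hom(subvs_of H, R[i]^o))
    (datum : cartan_borel_datum q b2 B eps)
    (h : subvs_of H) (h_def : is_eps0_check eps h)
    (mu : 'I_r.+1 -> rat) (mu_dom : dominant_integral b2 mu)
    (W : vectType R[i]) (rho : 'End(V) -> 'End(W))
    (W_irr : irreducible_so_module q rho)
    (W_hw : has_highest_weight B rho (weight_of eps mu)) :
  (0 <= mu ord_max ->
    s_const (rho (vsval h)) =
      8 * (((\sum_i mu i) * b2%:R +
            \sum_i ((mu i - (i : nat)%:R) ^+ 2 - (i : nat)%:R ^+ 2)) /
           ((b2%:R + 1) * (b2%:R + 2)))) /\
  (~~ odd b2 -> mu ord_max < 0 ->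
    forall (W' : vectType R[i]) (rho' : 'End(V) -> 'End(W')),
      irreducible_so_module q rho' ->
      has_highest_weight B rho' (weight_of eps (flip_last mu)) ->
      s_const (rho (vsval h)) = s_const (rho' (vsval h))).
Proof.
have [m mu0] : exists m : int, 2 * mu ord0 = m%:~R.
  have [[/(_ ord0)[n ->]|/(_ ord0)[n ->]] _ _ _] := mu_dom.
    by exists (2 * n); rewrite intrM.
  by exists (2 * n + 1); rewrite intrD intrM mulrDr mulfV.
have formula := s_const_highest_weight q_nondeg r_def dimV datum h_def.
split=> [_|b2_even _ W' rho' W'_irr W'_hw].
  exact: (formula _ _ W_irr _ m).
have flip0 : flip_last mu ord0 = mu ord0.
  have r_gt0 : (0 < r)%N by rewrite r_def half_gt0 ltnW.
  rewrite /flip_last; case: eqP => // /(congr1 val) /= r0.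
  by rewrite -r0 in r_gt0.
rewrite (formula _ _ W_irr _ _ W_hw mu0).
rewrite (formula _ _ W'_irr _ m W'_hw); last by rewrite flip0.
congr (8 * (_ / _)); rewrite !mulr_suml -!big_split; apply: eq_bigr => i _ /=.
(* only mu_r ^ 2 and mu_r * (b2 - 2 r) involve mu_r, and b2 = 2 r *)
rewrite /flip_last; case: eqP => [->|_] //=.
have -> : b2 = (r * 2)%N.
  by rewrite muln2 r_def -[LHS]odd_double_half (negPf b2_even).
by rewrite natrM; ring.
Qed.
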